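(* Let $(E,\mathcal{B},P,B_0,\alpha)$ be a conservative interleaving bandit with $E=[L]$, matroid rank $K$ and $\alpha=1/K$, and let the algorithm I-UCB2 be run on it with horizon $n$ (a multiple of $K$). Let $A_1,\dots,A_n$ be the successive actions (bases) taken by I-UCB2. Then, with probability at least $1-\frac{2L}{Kn}$, for every step $t\in[n]$ there exists a bijection $\rho_{A_t,B_0}:A_t\to B_0$ such that $$\sum_{e\in A_t}\mathbf{1}\{\bar w(e)\ge \bar w(\rho_{A_t,B_0}(e))\}\ \ge\ (1-\alpha)K \;=\; K-1 .$$
   Context: **Problem.** A conservative interleaving bandit is a tuple $(E,\mathcal{B},P,B_0,\alpha)$: $E=[L]=\{1,\dots,L\}$ is a finite set of items; $\mathcal{B}$ is the collection of bases of a matroid on $E$ of rank $K$ (each basis has $K$ elements); $P$ is a probability distribution on $[0,1]^L$ (unknown to the learner); $B_0\in\mathcal{B}$ is the input baseline basis; $\alpha\in[0,1]$ is a tolerance. $\bar w=\mathbb{E}_{w\sim P}[w]\in[0,1]^L$ denotes the vector of expected weights. Each time the learner takes an action $A\in\mathcal{B}$, a fresh weight vector $w\sim P$, independent of the past, is drawn, and the learner observes $w(e)$ for every $e\in A$ (semi-bandit feedback). **Bijective exchange (known matroid fact).** For any two bases $B_1,B_2$ there is a bijection $\rho:B_1\to B_2$ such that $(B_1\setminus\{e\})\cup\{\rho(e)\}\in\mathcal{B}$ for every $e\in B_1$. **Algorithm I-UCB2 (the means of the items of $B_0$ are not known to the learner).** Let $c_{n,s}=\sqrt{1.5\log(n)/s}$.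 Initialization: one vector $w_0\sim P$ is observed in full, so every item has one observation. The algorithm then proceeds in rounds $r=1,2,\dots,n/K$; each round consists of $K$ actions, so there are $n$ actions (steps) in total. For item $e$ let $T_{r-1}(e)$ be the number of observations of $e$ made before round $r$ (including the initial one), and let $\hat w_{s}(e)$ be the average of its first $s$ observed weights. In round $r$: 1. Compute, for all $e\in E$, $U_r(e)=\hat w_{T_{r-1}(e)}(e)+c_{n,T_{r-1}(e)}$ and $L_r(e)=\max\{\hat w_{T_{r-1}(e)}(e)-c_{n,T_{r-1}(e)},0\}$. 2. Let the decision set $D_r$ be a maximum-weight basis with respect to the weights $U_r$. 3. Set $v_r(e)=U_r(e)$ for $e\in B_0$ and $v_r(e)=L_r(e)$ for $e\in E\setminus B_0$; let the baseline set $B_r$ be a maximum-weight basis with respect to the weights $v_r$. 4. Let $\rho_r:B_r\to D_r$ be a bijection as in the bijective exchange fact. For each $e\in B_r$ in turn, take the action $(B_r\setminus\{e\})\cup\{\rho_r(e)\}$, observe the weights of its items under a fresh draw from $P$, and update the statistics. *)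

(* Defs.v *)
From HB Require Import structures.
From mathcomp Require Import all_boot all_order all_algebra.
From mathcomp Require Import all_classical all_reals all_analysis.

Set Implicit Arguments.
Unset Strict Implicit.
Unset Printing Implicit Defensive.

Import Order.TTheory GRing.Theory Num.Theory.
Import numFieldNormedType.Exports.

Local Open Scope classical_set_scope.
Local Open Scope ring_scope.

Definition is_matroid_bases (L : nat) (Bs : {set {set 'I_L}}) : Prop :=
  Bs != finset.set0 /\
  forall B1 B2 : {set 'I_L}, B1 \in Bs -> B2 \in Bs ->
  forall x : 'I_L, x \in B1 :\: B2 ->
  exists2 y : 'I_L, y \in B2 :\: B1 & y |: (B1 :\ x) \in Bs.

(* Only the values of rho on B1 matter. *)
Definition bijection_between (L : nat) (B1 B2 : {set 'I_L})
    (rho : 'I_L -> 'I_L) : Prop :=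
  {in B1 &, injective rho} /\ rho @: B1 = B2.

Definition bijective_exchange (L : nat) (Bs : {set {set 'I_L}})
    (B1 B2 : {set 'I_L}) (rho : 'I_L -> 'I_L) : Prop :=
  bijection_between B1 B2 rho /\
  forall e : 'I_L, e \in B1 -> rho e |: (B1 :\ e) \in Bs.

Definition max_weight_basis (R : realType) (L : nat) (Bs : {set {set 'I_L}})
    (v : 'I_L -> R) (B : {set 'I_L}) : Prop :=
  B \in Bs /\
  forall B' : {set 'I_L}, B' \in Bs -> \sum_(e in B') v e <= \sum_(e in B) v e.

(* Items are numbered from 0; a weight vector is an L.-tuple of reals, which
   carries the product (Borel) sigma-algebra. *)
Record conservative_bandit (R : realType) (L : nat) := ConservativeBandit {
  bases : {set {set 'I_L}} ;
  rank : nat ;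
  law : probability (L.-tuple (measurableTypeR R)) R ;
  baseline : {set 'I_L} ;
  tolerance : R ;
  basesP : is_matroid_bases bases ;
  rankP : forall B : {set 'I_L}, B \in bases -> #|B| = rank ;
  lawP : law [set w : L.-tuple (measurableTypeR R) |
    forall e : 'I_L, 0 <= (tnth w e : R) <= 1] = 1%E ;
  baselineP : baseline \in bases ;
  toleranceP : 0 <= tolerance <= 1
}.

Definition mean_weight (R : realType) (L : nat) (X : conservative_bandit R L)
    (e : 'I_L) : R :=
  fine ('E_(law X)[fun w : L.-tuple (measurableTypeR R) => (tnth w e : R)])%E.

(* Statistics along one trajectory: [w t] is the weight vector of draw [t] and
   [A t] the action taken at step [t].  Draw 0 is the initial full observation,
   so [A 0] is irrelevant; the n actions are [A 1], ..., [A n]. *)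
Section Trajectory.
Context (R : realType) (L : nat) (X : conservative_bandit R L) (n : nat).
Context (w : nat -> 'I_L -> R) (A : nat -> {set 'I_L}).

Definition observation_times (m : nat) (e : 'I_L) : seq nat :=
  [seq t <- iota 0 m | (t == 0)%N || (e \in A t)].

(* The first r rounds use the draws 0, ..., r * K. *)
Definition num_obs (r : nat) (e : 'I_L) : nat :=
  size (observation_times (r * rank X).+1 e).

Definition emp_mean (s : nat) (e : 'I_L) : R :=
  (\sum_(t <- take s (observation_times n.+1 e)) w t e) / s%:R.

Definition radius (s : nat) : R := Num.sqrt (3 / 2 * ln n%:R / s%:R).

(* [ucb r] and [lcb r] are the indices computed after r completed rounds, i.e.
   U_{r+1} and L_{r+1} when rounds are numbered from 1. *)
Definition ucb (r : nat) (e : 'I_L) : R :=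
  emp_mean (num_obs r e) e + radius (num_obs r e).

Definition lcb (r : nat) (e : 'I_L) : R :=
  Num.max (emp_mean (num_obs r e) e - radius (num_obs r e)) 0.

Definition baseline_index (r : nat) (e : 'I_L) : R :=
  if e \in baseline X then ucb r e else lcb r e.

(* The round following r completed rounds consists of the steps
   r * K + 1, ..., r * K + K; [sigma] is the order in which the items of the
   baseline set B are exchanged.  Ties in the choice of D, B, rho and sigma may
   be broken in any way. *)
Definition iucb2_round (r : nat) : Prop :=
  exists (D B : {set 'I_L}) (rho : 'I_L -> 'I_L) (sigma : 'I_(rank X) -> 'I_L),
    [/\ max_weight_basis (bases X) (ucb r) D,
        max_weight_basis (bases X) (baseline_index r) B,
        bijective_exchange (bases X) B D rho,
        injective sigma /\ [set sigma j | j in 'I_(rank X)]%SET = B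
      & forall j : 'I_(rank X),
          A (r * rank X + j).+1 = rho (sigma j) |: (B :\ sigma j)].

End Trajectory.

(* A run with horizon n on a probability space (Omega, Pr).  [W t] is the weight
   vector of draw t, [A t] the action of step t, and [F t] the sigma-algebra of
   the events determined before draw t: all earlier draws and any internal
   randomness of the learner used so far (e.g. for breaking ties). *)
Record iucb2_run (R : realType) (L : nat) (X : conservative_bandit R L)
    (n : nat) (d : measure_display) (Omega : measurableType d)
    (Pr : probability Omega R) (F : nat -> set (set Omega))
    (W : nat -> Omega -> L.-tuple (measurableTypeR R))
    (A : nat -> Omega -> {set 'I_L}) : Prop := {
  past_sigma_algebra : forall t, sigma_algebra setT (F t) ;
  past_measurable : forall t, F t `<=` measurable ;
  past_increasing : forall t, F t `<=` F t.+1 ;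
  draw_past : forall t, (t <= n)%N ->
    forall S, measurable S -> F t.+1 (W t @^-1` S) ;
  draw_law : forall t, (t <= n)%N ->
    forall S, measurable S -> Pr (W t @^-1` S) = law X S ;
  draw_fresh : forall t, (t <= n)%N ->
    forall G S, F t G -> measurable S ->
    Pr (G `&` W t @^-1` S) = (Pr G * Pr (W t @^-1` S))%E ;
  action_past : forall t, (1 <= t <= n)%N ->
    forall C : {set 'I_L}, F t [set x | A t x = C] ;
  action_rule : forall (x : Omega) (r : nat), (r < n %/ rank X)%N ->
    iucb2_round X n (fun t e => tnth (W t x) e) (A ^~ x) r
}.

(* Main.v *)
From HB Require Import structures.
Require Import Defs.
From mathcomp Require Import all_boot all_order all_algebra.
From mathcomp Require Import all_classical all_reals all_analysis.
From mathcomp Require Import measurable_realfun.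
From mathcomp Require Import ring lra zify.

Import Order.TTheory GRing.Theory Num.Theory.
Import numFieldNormedType.Exports.

Local Open Scope classical_set_scope.
Local Open Scope ring_scope.

(** The baseline set B of a round maximises the weights v, so B can be matched
    with the baseline basis B0 by a bijection s that fixes the common items and
    satisfies v (s e) <= v e.  If all confidence intervals are valid, then for
    e in B but not in B0, mean (s e) <= U (s e) = v (s e) <= v e = L e <= mean e.
    An action replaces a single item of B, so at most one inequality is lost.

    Validity: fix an item e, a number s of observations and a sign.  With
    lambda = +-4 c, c = sqrt (1.5 ln n / s), the product over the first s
    observations w of e of exp (lambda (w - mean) - lambda^2 / 8) has expectation
    at most 1 (Hoeffding's lemma, the draws being independent of the past), and it
    is at least exp (2 s c^2) = n^3 when the average deviates by more than c on
    that side.  By Markov's inequality and a union bound over e, s <= n and the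
    sign, the failure probability is at most 2 L n / n^3 <= 2 L / (K n). *)

(** * Matching bases of a matroid *)

(** Induction on the size of [B0 :\: B]. Exchanging the lightest [y] of [B0 :\: B] for some [x] of
    [B :\: B0] gives a basis closer to [B]. Its matching fixes [x], which is now a common item, and
    redirecting [x] to [y] gives a matching with [B0]. *)
Lemma max_weight_basis_matching (R : realType) (L : nat)
    (Bs : {set {set 'I_L}}) (v : 'I_L -> R) (B B0 : {set 'I_L}) :
  is_matroid_bases Bs -> max_weight_basis Bs v B -> B0 \in Bs ->
  exists2 s : 'I_L -> 'I_L, bijection_between B B0 s &
    (forall e, e \in B -> v (s e) <= v e) /\
    (forall e, e \in B -> e \in B0 -> s e = e).
Proof.
move=> [_ exch] [BBs Bmax].
have [m] := ubnP #|B0 :\: B|; elim: m B0 => // m IH B0 cardB0 B0Bs.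
have [B0B | [y0 y0P]] := set_0Vmem (B0 :\: B).
  (* An item of [B] outside [B0] would have to be exchanged for one of the empty set [B0 :\: B]. *)
  have BB0 : B \subset B0.
    rewrite -finset.setD_eq0; apply/eqP/setP => x; rewrite finset.in_set0.
    apply/negP => /(exch B B0 BBs B0Bs)[y]; by rewrite B0B finset.in_set0.
  have B0E : B = B0.
    by apply/eqP; rewrite finset.eqEsubset BB0 -finset.setD_eq0 B0B eqxx.
  exists id; last by split.
  split; first by move=> ? ? ? ?.
  by rewrite -B0E; apply/setP => x; rewrite mem_imset.
(* Since [B] is optimal, exchanging any item of [B :\: B0] shows that it weighs
   at least as much as the lightest item [y] of [B0 :\: B]. *)
pose y := [arg min_(i < y0 | i \in B0 :\: B) v i]%O.
have [yP ymin] : y \in B0 :\: B /\ forall z, z \in B0 :\: B -> v y <= v z.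
  by rewrite /y; case: arg_minP => // i iP imin; split.
have [x xP xBs] := exch B0 B B0Bs BBs y yP.
move: (xP) (yP); rewrite !finset.in_setD => /andP[xB0 xB] /andP[yB yB0].
have yx : v y <= v x.
  have [z zP zBs] := exch B B0 BBs B0Bs x xP.
  apply: (le_trans (ymin z zP)).
  have := Bmax _ zBs.
  rewrite finset.in_setD in zP; case/andP: zP => zB zB0.
  rewrite big_setU1 ?inE ?(negbTE zB) ?andbF//=.
  by rewrite (big_setD1 x xB)/= lerD2r.
have sub : (x |: (B0 :\ y)) :\: B \proper B0 :\: B.
  apply/fintype.properP; split.
    by apply/fintype.subsetP => z; rewrite !inE => /andP[zB /orP[/eqP zx|/andP[_ ->]]];
      [rewrite zx xB in zB | rewrite zB].
  by exists y => //; rewrite !inE eqxx (negbTE yB)/= orbF; apply: contraNN yB => /eqP ->.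
have [|s [sinj simg] [sle sid]] := IH (x |: (B0 :\ y)) _ xBs.
  by apply: leq_trans (proper_card sub) _.
have sxx : s x = x by apply: sid => //; rewrite !inE eqxx.
have sy e : e \in B -> e != x -> s e != x.
  by move=> eB; apply: contraNN => /eqP se; apply/eqP/sinj; rewrite ?sxx.
have sB0 e : e \in B -> e != x -> (s e \in B0) && (s e != y).
  move=> eB ex; have : s e \in x |: (B0 :\ y) by rewrite -simg imset_f.
  by rewrite !inE (negbTE (sy _ eB ex))/= andbC.
exists (fun e => if e == x then y else s e); split.
- move=> e f eB fB /=.
  case: eqP => [->|/eqP ex]; case: eqP => [->|/eqP fx] //.
  + by move=> yE; have := sB0 f fB fx; rewrite -yE eqxx andbF.
  + by move=> yE; have := sB0 e eB ex; rewrite yE eqxx andbF.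
  + exact: sinj.
- apply/setP => z; apply/imsetP/idP => [[e eB ->]|zB0].
    by case: eqP => // /eqP ex; case/andP: (sB0 e eB ex).
  have [->|zy] := eqVneq z y; first by exists x => //; rewrite eqxx.
  have : z \in x |: (B0 :\ y) by rewrite !inE zB0 zy orbT.
  rewrite -simg => /imsetP[e eB ze]; exists e => //.
  by case: eqP => // ex; move: zB0; rewrite ze ex sxx (negbTE xB0).
- by move=> e eB; case: eqP => [->//|_]; apply: sle.
- move=> e eB eB0; case: eqP => [ex|_]; first by rewrite -ex eB0 in xB0.
  by apply: sid => //; rewrite !inE eB0 andbT; apply/orP; right;
     apply: contraNN yB => /eqP <-.
Qed.

(** The new item [b] inherits the partner of [a] and all other items keep theirs, so only the
    inequality at [b] can fail. The case [b = a] is allowed. *)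
Lemma exchange_matching (R : realType) (L : nat) (B B0 : {set 'I_L})
    (mu : 'I_L -> R) (s : 'I_L -> 'I_L) (a b : 'I_L) :
  bijection_between B B0 s -> (forall e, e \in B -> mu (s e) <= mu e) ->
  a \in B -> b \notin B :\ a ->
  exists2 t : 'I_L -> 'I_L, bijection_between (b |: (B :\ a)) B0 t &
    #|B|%:R - 1 <= \sum_(e in b |: (B :\ a)) (mu (t e) <= mu e)%R%:R :> R.
Proof.
move=> [sinj simg] sle aB bB.
have bne e : e \in B :\ a -> (e == b) = false.
  by move=> eB; apply: contraNF bB => /eqP <-.
exists (fun e => if e == b then s a else s e); first split.
- move=> e f; rewrite !(finset.in_setU1 _ b) => /predU1P[->|eB] /predU1P[->|fB] //;
    rewrite ?eqxx ?bne //.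
  + move: fB; rewrite !inE => /andP[fa fB] /(sinj _ _ aB fB) afE.
    by rewrite afE eqxx in fa.
  + move: eB; rewrite !inE => /andP[ea eB] /(sinj _ _ eB aB) aeE.
    by rewrite aeE eqxx in ea.
  + by move: eB fB; rewrite !inE => /andP[_ eB] /andP[_ fB]; exact: sinj.
- rewrite -simg; apply/setP => z; apply/imsetP/imsetP => [[e]|[e eB ->]].
    rewrite finset.in_setU1 => /predU1P[->|eB] ->; first by exists a; rewrite ?eqxx.
    by exists e; rewrite ?bne//; move: eB; rewrite !inE => /andP[].
  have [->|ea] := eqVneq e a; first by exists b; rewrite ?eqxx ?finset.setU11.
  have eB' : e \in B :\ a by rewrite !inE ea.
  by exists e; rewrite ?bne// finset.in_setU1 eB' orbT.
- rewrite big_setU1//= (eq_bigr (fun=> 1)) => [|e eB]; last first.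
    by rewrite bne// sle//; move: eB; rewrite !inE => /andP[].
  rewrite sumr_const (cardsD1 a B) aB natrD addrAC subrr add0r.
  by rewrite lerDr ler0n.
Qed.

(** * Moment generating function of a Bernoulli variable *)

(* [g t = t^2/8 + p t - ln (1 - p + p e^t)] has [g 0 = g' 0 = 0] and
   [g'' = 1/4 - q (1 - q) >= 0], where [q = p e^t / (1 - p + p e^t)]. *)
Lemma bernoulli_mgf_ge0 (R : realType) (p t : R) : 0 <= p <= 1 -> 0 <= t ->
  1 - p + p * expR t <= expR (t * p + t ^+ 2 / 8).
Proof.
move=> /andP[p0 p1] t0.
pose D : R -> R := fun x => 1 - p + p * expR x.
have D0 x : 0 < D x.
  rewrite /D; have e0 := expR_gt0 x.
  have [->|pn] := eqVneq p 1; first by rewrite subrr add0r mul1r.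
  by rewrite ltr_wpDr ?mulr_ge0 ?(ltW e0)// subr_gt0 lt_neqAle pn.
have dD (x : R) : is_derive x 1 D (p * expR x).
  apply: (is_derive_eq (is_deriveD (is_derive_cst (1 - p) x 1)
    (is_deriveZ p (is_derive_expR x)))).
  by rewrite add0r.
(* [h] and [h'] are the first two derivatives of the function [g] introduced below. *)
pose h : R -> R := fun x => 4^-1 * x + p - p * expR x * (D x)^-1.
pose h' : R -> R := fun x => 1 / 4 - p * expR x * (1 - p) / D x ^+ 2.
have dh (x : R) : is_derive x 1 h (h' x).
  have Dn : D x != 0 by rewrite gt_eqF.
  apply: (is_derive_eq (is_deriveB (is_deriveD
    (is_deriveZ (4^-1 : R) (is_derive_id x 1)) (is_derive_cst p x 1))
    (is_deriveM (is_deriveZ p (is_derive_expR x)) (is_deriveV Dn (dD x))))).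
  rewrite /GRing.scale/= /h'; rewrite /D in Dn *.
  rewrite -[p *: expR x]/(p * expR x); field; exact: Dn.
have h'0 x : 0 <= h' x.
  rewrite /h' subr_ge0 ler_pdivrMr ?exprn_gt0//.
  rewrite /D -subr_ge0.
  (* With [a = 1 - p] and [b = p * expR x], this is [(a + b)^2 / 4 - a b = ((a - b) / 2)^2]. *)
  have -> : 1 / 4 * (1 - p + p * expR x) ^+ 2 - p * expR x * (1 - p) =
    ((1 - p - p * expR x) / 2) ^+ 2 by field.
  exact: sqr_ge0.
(* Used twice: to pass from [h'] to [h], then from [h] to [g]. *)
have mono (f f' : R -> R) : (forall x : R, is_derive x 1 f (f' x)) ->
    (forall x, 0 <= x -> 0 <= f' x) -> f 0 = 0 -> forall x, 0 <= x -> 0 <= f x.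
  move=> df f'0 f00 x x0; rewrite -[X in X <= _]f00.
  apply: (@ger0_derive1_ndecry _ f 0) => //.
  - move=> y; rewrite in_itv/= andbT => /ltW y0.
    by rewrite derive1E (@derive_val _ _ _ _ _ _ _ (df y)); apply: f'0.
  - apply: derivable_within_continuous => y _; have dfy := df y.
    exact: (@ex_derive _ _ _ _ _ _ _ dfy).
have h0 x : 0 <= x -> 0 <= h x.
  apply: (mono h h' dh) => //.
  by rewrite /h /D expR0; field; lra.
pose g : R -> R := fun x => 8^-1 * (x * x) + p * x - ln (D x).
have dg (x : R) : is_derive x 1 g (h x).
  have Dn : D x != 0 by rewrite gt_eqF.
  apply: (is_derive_eq (is_deriveB (is_deriveD
    (is_deriveZ (8^-1 : R) (is_deriveM (is_derive_id x 1) (is_derive_id x 1)))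
    (is_deriveZ p (is_derive_id x 1)))
    (is_derive1_comp (is_derive1_ln (D0 x)) (dD x)))).
  rewrite /GRing.scale/= /h; by field.
have g0 : 0 <= g t.
  apply: (mono g h) => //; rewrite /g /D expR0 -[RHS](ln1 R).
  by rewrite mulr1 subrK ln1; ring.
have -> : 1 - p + p * expR t = expR (ln (D t)) by rewrite lnK// posrE.
by rewrite ler_expR; move: g0; rewrite /g; lra.
Qed.

(** For negative [t] the two outcomes are swapped: the bound for [1 - p] and [- t], multiplied by
    [expR t], is the one wanted. *)
Lemma bernoulli_mgf (R : realType) (p t : R) : 0 <= p <= 1 ->
  1 - p + p * expR t <= expR (t * p + t ^+ 2 / 8).
Proof.
move=> p01; have [t0|/ltW t0] := leP 0 t; first exact: bernoulli_mgf_ge0.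
have := @bernoulli_mgf_ge0 R (1 - p) (- t) ltac:(lra) ltac:(lra).
rewrite -(ler_pM2l (expR_gt0 t)) -expRD.
have := expRxMexpNx_1 t; set u := expR t; set u' := expR (- t) => uu'.
rewrite (_ : u * _ = 1 - p + p * u); last by ring: uu'.
by rewrite (_ : t + _ = t * p + t ^+ 2 / 8)//; field.
Qed.

Lemma expR_chord (R : realType) (t x : R) : 0 <= x <= 1 ->
  expR (t * x) <= 1 - x + x * expR t.
Proof.
move=> /andP[x0 x1].
have := @convex_expR R (Itv01 x0 x1) t 0.
rewrite !convRE/= expR0 mulr0 addr0 mulr1.
by rewrite [X in _ <= X -> _]addrC [x * t]mulrC.
Qed.

(** * Integration against a draw independent of the past *)

(** Agreement on rectangles makes the joint law of [U] and [V] the product of the law of [U] and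
    [Q]; Tonelli's theorem then applies to the nonnegative [h]. *)
Lemma integral_indep (R : realType) (d d1 d2 : measure_display)
    (Omega : measurableType d) (T : measurableType d1) (Y : measurableType d2)
    (Pr : probability Omega R) (Q : probability Y R)
    (U : Omega -> T) (V : Omega -> Y) (h : T * Y -> \bar R) :
  measurable_fun setT U -> measurable_fun setT V ->
  (forall G S, measurable G -> measurable S ->
     Pr (U @^-1` G `&` V @^-1` S) = (Pr (U @^-1` G) * Q S)%E) ->
  measurable_fun setT h -> (forall z, (0 <= h z)%E) ->
  (\int[Pr]_x h (U x, V x) = \int[Pr]_x \int[Q]_y h (U x, y))%E.
Proof.
move=> mU mV UV mh h0.
pose fU : {mfun Omega >-> T} := HB.pack U (isMeasurableFun.Build _ _ _ _ _ mU).
pose P1 : probability T R := distribution Pr fU.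
pose Z : Omega -> (T * Y)%type := fun x => (U x, V x).
have mZ : measurable_fun setT Z by exact: measurable_fun_pair.
pose fZ : {mfun Omega >-> (T * Y)%type} :=
  HB.pack Z (isMeasurableFun.Build _ _ _ _ _ mZ).
have prodE S : measurable S -> (P1 \x Q)%E S = distribution Pr fZ S.
  by apply: product_measure_unique => A B mA mB; exact: UV.
transitivity (\int[distribution Pr fZ]_z h z)%E.
  by rewrite ge0_integral_pushforward.
transitivity (\int[P1 \x Q]_z h z)%E.
  apply: eq_measure_integral => S mS _; exact: (esym (prodE S mS)).
rewrite fubini_tonelli1// ge0_integral_pushforward// => [|x _].
  exact: measurable_fun_fubini_tonelli_F.
exact: integral_ge0.
Qed.

(* One step of the supermartingale: [U] is the past, [V] the fresh draw. *)
Lemma integral_step_le (R : realType) (d d1 d2 : measure_display)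
    (Omega : measurableType d) (T : measurableType d1) (Y : measurableType d2)
    (Pr : probability Omega R) (Q : probability Y R)
    (U : Omega -> T) (V : Omega -> Y)
    (M : T -> R) (o : T -> bool) (g : Y -> R) :
  measurable_fun setT U -> measurable_fun setT V ->
  (forall G S, measurable G -> measurable S ->
     Pr (U @^-1` G `&` V @^-1` S) = (Pr (U @^-1` G) * Q S)%E) ->
  measurable_fun setT M -> (forall x, 0 <= M x) -> measurable_fun setT o ->
  measurable_fun setT g -> (forall y, 0 <= g y) ->
  (\int[Q]_y (g y)%:E <= 1)%E ->
  (\int[Pr]_x (M (U x) * (if o (U x) then g (V x) else 1))%:E <=
   \int[Pr]_x (M (U x))%:E)%E.
Proof.
move=> mU mV UV mM M0 mo mg g0 g1.
pose h (z : T * Y) : \bar R := (M z.1 * (if o z.1 then g z.2 else 1))%:E.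
have h0 z : (0 <= h z)%E.
  by rewrite lee_fin mulr_ge0//; case: ifP.
have mh : measurable_fun setT h.
  apply/measurable_EFinP/measurable_funM; first exact: measurableT_comp.
  apply: measurable_fun_ifT => //; exact: measurableT_comp.
rewrite (integral_indep _ _ _ _ _ _ _ _ _ _ _ h mU mV UV mh h0).
apply: ge0_le_integral => //.
- by move=> x _; apply: integral_ge0.
- have mF : measurable_fun setT (fubini_F Q h).
    exact: measurable_fun_fubini_tonelli_F.
  exact: (measurableT_comp mF mU).
- by apply/measurable_EFinP; exact: measurableT_comp.
(* For a fixed past the inner integral is either [M] times the mean of [g], or [M] itself. *)
- move=> x _; rewrite /h/=; case: (o (U x)).
    under eq_integral do rewrite EFinM.
    rewrite ge0_integralZl//; last first.
    + by rewrite lee_fin.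
    + by move=> y _; rewrite lee_fin.
    + exact/measurable_EFinP.
    by rewrite -[leRHS]mule1 lee_wpmul2l// lee_fin.
  by rewrite integral_cst//= probability_setT mule1 mulr1.
Qed.

(** * Hoeffding's lemma *)

(** By convexity [expR (t * f y)] lies below its chord over [0, 1], and the mean
    [1 - m + m * expR t] of the chord is the moment generating function of a Bernoulli variable of
    parameter [m]. *)
Lemma hoeffding_mgf (R : realType) (d : measure_display)
    (Y : measurableType d) (Q : probability Y R) (f : Y -> R) (m t : R) :
  measurable_fun setT f -> (forall y, 0 <= f y <= 1) ->
  (\int[Q]_y (f y)%:E = m%:E)%E ->
  (\int[Q]_y (expR (t * (f y - m) - t ^+ 2 / 8))%:E <= 1)%E.
Proof.
move=> mf f01 fm.
have f0 y : 0 <= f y by case/andP: (f01 y).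
have f1 y : 0 <= 1 - f y by rewrite subr_ge0; case/andP: (f01 y).
have mf' : measurable_fun setT (fun y => 1 - f y) by exact: measurable_funB.
(* The integrals of [1 - f] and [f] are nonnegative and add up to 1, so the first one is finite and
   is found by subtraction. *)
have int1f : (\int[Q]_y (1 - f y)%:E = (1 - m)%:E)%E.
  have : (\int[Q]_y (1 - f y + f y)%:E = 1)%E.
    under eq_integral do rewrite subrK.
    by rewrite integral_cst//= probability_setT mul1e.
  under eq_integral do rewrite EFinD.
  rewrite ge0_integralD//; do ?[exact/measurable_EFinP | by move=> y _; rewrite lee_fin].
  rewrite fm; case: (integral _ _ _) => [r| |]//= [] rm.
  by congr EFin; rewrite -rm addrK.
have m0 : 0 <= m by rewrite -lee_fin -fm; apply: integral_ge0 => y _; rewrite lee_fin.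
have m1 : m <= 1.
  by rewrite -subr_ge0 -lee_fin -int1f; apply: integral_ge0 => y _; rewrite lee_fin.
have c0 : 0 <= expR (- (t * m) - t ^+ 2 / 8) := expR_ge0 _.
have chord : (\int[Q]_y (expR (t * f y))%:E <= (1 - m + m * expR t)%:E)%E.
  apply: (@le_trans _ _ (\int[Q]_y ((1 - f y)%:E + (expR t)%:E * (f y)%:E))%E).
    apply: ge0_le_integral => //; do ?[by move=> y _; rewrite lee_fin expR_ge0
      | by move=> y _; rewrite -EFinM -EFinD lee_fin addr_ge0// mulr_ge0// expR_ge0].
    - by apply/measurable_EFinP; apply: measurableT_comp => //; exact: measurable_funM.
    - apply/measurable_EFinP => /=; apply: measurable_funD => //.
      exact: measurable_funM.
    - move=> y _; rewrite -EFinM -EFinD lee_fin [expR t * _]mulrC.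
      exact: expR_chord.
  rewrite ge0_integralD//; do ?[exact/measurable_EFinP | by move=> y _; rewrite lee_fin
    | by move=> y _; rewrite -EFinM lee_fin mulr_ge0// expR_ge0
    | by apply/measurable_EFinP; exact: measurable_funM].
  rewrite ge0_integralZl//; do ?[exact/measurable_EFinP | by move=> y _; rewrite lee_fin
    | by rewrite lee_fin expR_ge0].
  by rewrite int1f fm -EFinM -EFinD [expR t * _]mulrC.
rewrite (eq_integral (fun y =>
    (expR (- (t * m) - t ^+ 2 / 8))%:E * (expR (t * f y))%:E)%E); last first.
  by move=> y _; rewrite -EFinM -expRD; congr (expR _)%:E; ring.
rewrite ge0_integralZl//; do ?[by move=> y _; rewrite lee_fin expR_ge0
  | by apply/measurable_EFinP; apply: measurableT_comp => //; exact: measurable_funM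
  | by rewrite lee_fin expR_ge0].
apply: (le_trans (lee_wpmul2l _ chord)); first by rewrite lee_fin.
rewrite -EFinM lee_fin.
have /(ler_wpM2l c0) := @bernoulli_mgf R m t ltac:(by rewrite m0 m1).
rewrite -expRD (_ : - (t * m) - t ^+ 2 / 8 + (t * m + t ^+ 2 / 8) = 0); last by ring.
by rewrite expR0.
Qed.

(** The weights lie in [0, 1] only almost surely. Clipping [f] to [0, 1] changes it on a null set,
    hence changes no integral. *)
Lemma hoeffding_mgf_ae (R : realType) (d : measure_display)
    (Y : measurableType d) (Q : probability Y R) (f : Y -> R) :
  measurable_fun setT f -> {ae Q, forall y, 0 <= f y <= 1} ->
  exists m : R, [/\ (\int[Q]_y (f y)%:E = m%:E)%E, 0 <= m &
    forall t, (\int[Q]_y (expR (t * (f y - m) - t ^+ 2 / 8))%:E <= 1)%E].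
Proof.
move=> mf f01.
pose f' y := Num.max 0 (Num.min (f y) 1).
have mf' : measurable_fun setT f'.
  by apply: measurable_maxr => //; exact: measurable_minr.
have f'0 y : 0 <= f' y by rewrite le_max lexx.
have f'1 y : f' y <= 1 by rewrite ge_max ler01 ge_min lexx orbT.
have f'f (h : R -> R) : ae_eq Q setT (fun y => (h (f y))%:E) (fun y => (h (f' y))%:E).
  apply: filterS f01 => y /andP[y0 y1] _.
  by rewrite /f' (min_idPl y1) (max_idPr y0).
pose m := fine (\int[Q]_y (f' y)%:E).
have f'm : (\int[Q]_y (f' y)%:E = m%:E)%E.
  rewrite /m fineK// ge0_fin_numE; last by apply: integral_ge0 => y _; rewrite lee_fin.
  apply: (@le_lt_trans _ _ (\int[Q]_y (cst 1 y))%E); last first.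
    by rewrite integral_cst//= probability_setT mul1e ltry.
  by apply: ge0_le_integral => //; do ?[exact/measurable_EFinP
    | by move=> y _; rewrite lee_fin].
exists m; split.
- rewrite -f'm; apply: ae_eq_integral => //; [exact/measurable_EFinP..|].
  exact: (f'f id).
- by rewrite /m fine_ge0//; apply: integral_ge0 => y _; rewrite lee_fin.
- move=> t.
  have mh (k : Y -> R) : measurable_fun setT k ->
      measurable_fun setT (fun y => (expR (t * (k y - m) - t ^+ 2 / 8))%:E).
    move=> mk; apply/measurable_EFinP; apply: measurableT_comp => //.
    by apply: measurable_funB => //; apply: measurable_funM => //; exact: measurable_funB.
  have -> : (\int[Q]_y (expR (t * (f y - m) - t ^+ 2 / 8))%:E =
             \int[Q]_y (expR (t * (f' y - m) - t ^+ 2 / 8))%:E)%E.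
    apply: ae_eq_integral => //; [exact: mh..|].
    exact: (f'f (fun z => expR (t * (z - m) - t ^+ 2 / 8))).
  by apply: hoeffding_mgf => // y; rewrite f'0 f'1.
Qed.

(** * Products over the observed draws *)

Lemma filtration_mono (T : Type) (F : nat -> set (set T)) (i j : nat) :
  (forall k, F k `<=` F k.+1) -> (i <= j)%N -> F i `<=` F j.
Proof.
move=> Finc /subnK <-; elim: (j - i)%N => // k IH; rewrite addSn.
by move=> S FS; apply: Finc; exact: IH.
Qed.

(** Whether factor [i] is present is decided before draw [i], so each further factor has conditional
    mean at most 1: the partial products form a supermartingale. *)
Lemma thinned_product_le1 (R : realType) (d d' : measure_display)
    (Omega : measurableType d) (Y : measurableType d')
    (Pr : probability Omega R) (Q : probability Y R)
    (F : nat -> set (set Omega)) (V : nat -> Omega -> Y)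
    (o : nat -> Omega -> bool) (g : Y -> R) (N : nat) :
  (forall i, sigma_algebra setT (F i)) -> (forall i, F i `<=` measurable) ->
  (forall i, F i `<=` F i.+1) ->
  (forall i, (i < N)%N -> forall S, measurable S -> F i.+1 (V i @^-1` S)) ->
  (forall i, (i < N)%N -> forall G S, F i G -> measurable S ->
     Pr (G `&` V i @^-1` S) = (Pr G * Q S)%E) ->
  (forall i, (i < N)%N -> F i [set x | o i x]) ->
  measurable_fun setT g -> (forall y, 0 <= g y) ->
  (\int[Q]_y (g y)%:E <= 1)%E ->
  measurable_fun setT
    (fun x => \prod_(i < N) (if o i x then g (V i x) else 1)) /\
  (\int[Pr]_x (\prod_(i < N) (if o i x then g (V i x) else 1))%:E <= 1)%E.
Proof.
move=> sF Fm Finc FV fresh Fo mg g0 g1.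
have Fmono i j := filtration_mono _ F i j Finc.
have FE i : (F i).-sigma.-measurable = F i by exact: measurable_g_measurableTypeE.
have mF k : (k <= N)%N -> measurable_fun [set: g_sigma_algebraType (F k)]
    (fun x => \prod_(i < k) (if o i x then g (V i x) else 1)).
  move=> kN; apply: measurable_prod => i _.
  have iN : (i < N)%N := leq_trans (ltn_ord i) kN.
  apply: measurable_fun_ifT => //.
    apply: (measurable_fun_bool true); rewrite setTI FE.
    exact: (Fmono i k (ltnW (ltn_ord i)) _ (Fo i iN)).
  apply: (measurableT_comp mg) => _ S mS; rewrite setTI FE.
  exact: (Fmono i.+1 k (ltn_ord i) _ (FV i iN S mS)).
have mid i : @measurable_fun _ _ Omega (g_sigma_algebraType (F i)) setT id.
  by move=> _ S; rewrite FE => FS; rewrite setTI; exact: (Fm i).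
split; first exact: (measurableT_comp (mF N (leqnn N)) (mid N)).
suff: forall k, (k <= N)%N ->
    (\int[Pr]_x (\prod_(i < k) (if o i x then g (V i x) else 1))%:E <= 1)%E.
  by apply.
elim=> [_|k IH kN].
  under eq_integral do rewrite big_ord0.
  by rewrite integral_cst//= probability_setT mul1e.
apply: le_trans (IH (ltnW kN)).
under eq_integral do rewrite big_ord_recr/=.
(* The past is the identity map into [Omega] equipped with the sigma-algebra [F k]. *)
apply: (@integral_step_le R _ _ _ Omega (g_sigma_algebraType (F k)) Y Pr Q id (V k)
  (fun x => \prod_(i < k) (if o i x then g (V i x) else 1)) (o k) g) => //.
- by move=> _ S mS; rewrite setTI; apply: (Fm k.+1); exact: FV.
- by move=> G S; rewrite FE => FG mS; exact: fresh.
- exact: mF (ltnW kN).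
- by move=> x; apply: prodr_ge0 => i _; case: ifP.
- by apply: (measurable_fun_bool true); rewrite setTI FE; exact: Fo.
Qed.

Lemma markov_ge0 (R : realType) (d : measure_display) (Omega : measurableType d)
    (Pr : probability Omega R) (M : Omega -> R) (a : R) :
  measurable_fun setT M -> (forall x, 0 <= M x) -> 0 < a ->
  (\int[Pr]_x (M x)%:E <= 1)%E ->
  (Pr [set x | (a <= M x)%R] <= (a^-1)%:E)%E.
Proof.
move=> mM M0 a0 iM.
rewrite -[leRHS]mule1 -lee_pdivrMl ?invr_gt0// invrK.
have := @le_integral_comp_abse _ Omega R Pr setT measurableT (EFin \o M) a id
  (@measurable_id _ _ _) (fun _ => id) (fun _ _ _ _ => id)
  (proj2 (measurable_EFinP _ _) mM) a0.
rewrite setTI/= (_ : [set x | _] = [set x | (a <= M x)%R]); last first.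
  by apply/seteqP; split => x /=; rewrite ger0_norm// lee_fin.
by move=> H; apply: le_trans H _; under eq_integral do rewrite ger0_norm//.
Qed.

(** * Actions of a round with valid confidence intervals *)

Lemma iucb2_action_matching (R : realType) (L : nat)
    (X : conservative_bandit R L) (n : nat) (w : nat -> 'I_L -> R)
    (A : nat -> {set 'I_L}) (mu : 'I_L -> R) (r : nat) (j : 'I_(rank X)) :
  (forall e, 0 <= mu e) ->
  (forall e, `|emp_mean n w A (num_obs X A r e) e - mu e| <=
             Defs.radius R n (num_obs X A r e)) ->
  iucb2_round X n w A r ->
  exists2 t : 'I_L -> 'I_L,
    bijection_between (A (r * rank X + j).+1) (baseline X) t &
    (rank X)%:R - 1 <=
      \sum_(e in A (r * rank X + j).+1) (mu (t e) <= mu e)%R%:R :> R.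
Proof.
move=> mu0 good [D [B [rho [sigma [_ Bmax [_ rhoB] [_ sigmaB] ->]]]]].
have ucbP e : mu e <= ucb X n w A r e.
  by have := good e; rewrite ler_norml /ucb => /andP[]; lra.
(* Truncation at 0 keeps a lower bound because [mu] is nonnegative. *)
have lcbP e : lcb X n w A r e <= mu e.
  rewrite /lcb ge_max mu0 andbT.
  by have := good e; rewrite ler_norml => /andP[]; lra.
have BBs : B \in bases X by case: Bmax.
have [s sB [sle sid]] :=
  @max_weight_basis_matching _ _ _ _ _ _ (basesP X) Bmax (baselineP X).
have sB' : sigma j \in B by rewrite -sigmaB imset_f.
rewrite -(rankP BBs).
apply: (@exchange_matching _ _ _ _ _ s) => //.
(* A common item is its own partner; otherwise [s e] carries an upper index and [e] a lower one. *)
- move=> e eB; have [eB0|eB0] := boolP (e \in baseline X).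
    by rewrite sid.
  have se : s e \in baseline X by case: sB => _ <-; exact: imset_f.
  have := sle e eB; rewrite /baseline_index se (negbTE eB0) => le_se.
  exact: le_trans (ucbP _) (le_trans le_se (lcbP _)).
(* Otherwise the action would have fewer than [rank X] items. *)
- apply/negP => rB; have := rankP (rhoB _ sB').
  rewrite (_ : _ |: _ = B :\ sigma j); last first.
    by apply/finset.setUidPr; rewrite finset.sub1set.
  by move=> cardB; have := cardsD1 (sigma j) B; rewrite sB' cardB (rankP BBs); lia.
Qed.

(** * Deviations of the empirical means *)

(** The right-hand side tests each [i] on indices up to [i] only, so membership among the first [s]
    observations is decided before the draw. *)
Lemma take_filter_iota (P : pred nat) (s m : nat) :
  take s [seq i <- iota 0 m | P i] =
  [seq i <- iota 0 m | P i && (size [seq k <- iota 0 i | P k] < s)%N].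
Proof.
elim: m => // m IH.
rewrite -addn1 iotaD add0n !filter_cat take_cat /=.
set l := [seq k <- iota 0 m | P k].
have [sl|ls] := ltnP s (size l).
  by rewrite ltnNge (ltnW sl) andbF cats0 IH.
rewrite -IH (take_oversize ls) -subn_gt0.
by case: (P m); case: (s - size l)%N.
Qed.

Lemma sqr_radius (R : realType) (n s : nat) : (0 < n)%N -> (0 < s)%N ->
  2 * s%:R * Defs.radius R n s ^+ 2 = ln n%:R * 3%:R.
Proof.
move=> n0 s0; rewrite /Defs.radius sqr_sqrtr; last first.
  by rewrite divr_ge0// mulr_ge0// ln_ge0// ler1n.
have : (s%:R : R) != 0 by rewrite pnatr_eq0 -lt0n.
by move: (ln _) (s%:R : R) => l {s0}s sn; field.
Qed.

(* Draw [i] is among the first [s] observations of [e]. *)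
Definition counted {L : nat} (A : nat -> {set 'I_L}) (e : 'I_L) (s i : nat) :=
  ((i == 0) || (e \in A i)) && (size (observation_times A i e) < s)%N.

Lemma deviation_product (R : realType) (L : nat) (n s : nat)
    (w : nat -> 'I_L -> R) (A : nat -> {set 'I_L}) (e : 'I_L) (m : R) :
  (0 < n)%N -> (0 < s <= size (observation_times A n.+1 e))%N ->
  Defs.radius R n s < `|emp_mean n w A s e - m| ->
  exists b : bool, n%:R ^+ 3 <=
    \prod_(i < n.+1) (if counted A e s i then
       expR ((-1) ^+ b * 4 * Defs.radius R n s * (w i e - m) -
             ((-1) ^+ b * 4 * Defs.radius R n s) ^+ 2 / 8) else 1).
Proof.
move=> n0 /andP[s0 sn] dev.
pose c := Defs.radius R n s.
(* The sign makes [t * d] nonnegative. The factor 4 comes from maximising [u * c - u ^+ 2 / 8] over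
   [u]: the maximum [2 * c ^+ 2] is reached at [u = 4 * c]. *)
pose d := emp_mean n w A s e - m; exists (d < 0).
set t := _ * c; pose z i := t * (w i e - m) - t ^+ 2 / 8.
rewrite -(big_mkord xpredT (fun i => if counted A e s i then expR (z i) else 1)).
rewrite -big_mkcond /= -expR_sum -big_filter /index_iota subn0.
rewrite -take_filter_iota -/(observation_times A n.+1 e).
set S := take s _.
have sizeS : size S = s by rewrite size_takel.
have -> : \sum_(i <- S) z i = s%:R * (t * d) - s%:R * t ^+ 2 / 8.
  rewrite sumrB big_const_seq count_predT sizeS iter_addr_0 -mulr_sumr sumrB.
  rewrite big_const_seq count_predT sizeS iter_addr_0 /d /emp_mean -/S.
  have : (s%:R : R) != 0 by rewrite pnatr_eq0 -lt0n.
  rewrite -[m *+ s]mulr_natr -[_ / 8 *+ s]mulr_natr.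
  by move: (\sum_(i <- S) _) (s%:R : R) => W k k0; field.
have -> : t * d = 4 * c * `|d| by rewrite /t [in RHS]normrEsign; ring.
have -> : t ^+ 2 = 16 * c ^+ 2.
  by rewrite /t !exprMn sqrr_sign; ring.
have -> : n%:R ^+ 3 = expR (ln n%:R * 3%:R) :> R.
  by rewrite expRM_natr lnK// posrE ltr0n.
rewrite ler_expR -(sqr_radius _ _ s)// -/c.
have cd : 4 * c * c <= 4 * c * `|d|.
  by rewrite ler_wpM2l ?mulr_ge0 ?sqrtr_ge0// ltW.
have := ler_wpM2l (ler0n R s) cd; lra.
Qed.

(** * Tail bound for one item, one count and one sign *)

Lemma mean_weight_mgf (R : realType) (L : nat) (X : conservative_bandit R L)
    (e : 'I_L) :
  0 <= mean_weight X e /\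
  forall t, (\int[law X]_y
    (expR (t * ((tnth y e : R) - mean_weight X e) - t ^+ 2 / 8))%:E <= 1)%E.
Proof.
have mtn (i : 'I_L) : measurable_fun [set: L.-tuple (measurableTypeR R)]
    (fun w => tnth w i : R).
  exact: (@measurable_tnth _ (measurableTypeR R) L i).
pose U := [set w : L.-tuple (measurableTypeR R) |
  forall i : 'I_L, 0 <= (tnth w i : R) <= 1].
have mU : measurable U.
  rewrite (_ : U = \bigcap_(i in [set: 'I_L])
      ((fun w : L.-tuple (measurableTypeR R) => tnth w i : R) @^-1` `[0, 1])).
    apply: fin_bigcap_measurable => // i _; rewrite -[X in measurable X]setTI.
    exact: mtn.
  apply/seteqP; split => w wI i; first by move=> _; exact: wI.
  exact: (wI i I).
have ae01 : {ae law X, forall w : L.-tuple (measurableTypeR R),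
    0 <= (tnth w e : R) <= 1}.
  exists (~` U); split.
  - exact: measurableC.
  - by rewrite probability_setC// lawP subee.
  - by move=> w /= /[swap] wI; apply.
have [m [fm m0 mgf]] := hoeffding_mgf_ae _ _ _ _ _ (mtn e) ae01.
by rewrite /mean_weight unlock fm.
Qed.

(** Only actions at steps up to [i] are involved, and each is determined before its own draw. *)
Lemma counted_past (R : realType) (L : nat) (X : conservative_bandit R L)
    (n : nat) (d : measure_display) (Omega : measurableType d)
    (Pr : probability Omega R) (F : nat -> set (set Omega))
    (W : nat -> Omega -> L.-tuple (measurableTypeR R))
    (A : nat -> Omega -> {set 'I_L}) (e : 'I_L) (s i : nat) :
  iucb2_run X n Pr F W A -> (i <= n)%N ->
  F i [set x | counted (A ^~ x) e s i].
Proof.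
move=> run ilen.
have Fmono j k := filtration_mono _ F j k (past_increasing run).
have FE k : (F k).-sigma.-measurable = F k.
  exact: measurable_g_measurableTypeE (past_sigma_algebra run k).
have mobs (j : nat) : (j <= i)%N -> measurable_fun
    [set: g_sigma_algebraType (F i)] (fun x => (j == 0) || (e \in A j x)).
  move=> ji; apply: (measurable_fun_bool true); rewrite setTI.
  (* Draw 0 observes every item; [action_past] speaks of later steps only. *)
  have [->|j0] := eqVneq j 0%N.
    by rewrite (_ : _ @^-1` _ = setT)//; apply/seteqP; split.
  rewrite (_ : _ @^-1` _ = \bigcup_(C in [set C : {set 'I_L} | e \in C])
      [set x | A j x = C]); last first.
    apply/seteqP; split => x /=; first by move=> eA; exists (A j x).
    by move=> [C /= eC ->].
  apply: fin_bigcup_measurable => // C _; rewrite FE.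
  apply: (Fmono j i ji); apply: (action_past run).
  by rewrite lt0n j0 (leq_trans ji).
have mc : measurable_fun [set: g_sigma_algebraType (F i)]
    (fun x => counted (A ^~ x) e s i).
  apply: measurable_and; first exact: mobs.
  (* The count is rewritten as a real sum of indicators, each of them measurable. *)
  rewrite (_ : (fun x => _) = (fun x =>
      \sum_(j < i) (if (j == 0 :> nat) || (e \in A j x) then 1 else 0 : R) < s%:R)).
    apply: measurable_fun_ltr => //; apply: measurable_sum => j.
    by apply: measurable_fun_ifT => //; apply: mobs; exact: ltnW.
  apply/funext => x; rewrite /observation_times size_filter -sum1_count.
  rewrite -(ltr_nat R) natr_sum big_mkcond /=.
  by rewrite -(big_mkord xpredT (fun j => if (j == 0%N) || (e \in A j x) then 1 else 0 : R))
    /index_iota subn0.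
have := mc measurableT [set true] I; rewrite FE setTI; exact.
Qed.

Lemma measure_bigcup_fin_le (R : realType) (d : measure_display)
    (Omega : measurableType d) (mu : {measure set Omega -> \bar R})
    (I : finType) (B : I -> set Omega) (c : R) :
  (forall i, measurable (B i)) -> (forall i, (mu (B i) <= c%:E)%E) ->
  measurable (\bigcup_i B i) /\ (mu (\bigcup_i B i) <= (#|I|%:R * c)%:E)%E.
Proof.
move=> mB Bc.
have key (s : seq I) : measurable (\big[setU/set0]_(i <- s) B i) /\
    (mu (\big[setU/set0]_(i <- s) B i) <= ((size s)%:R * c)%:E)%E.
  elim: s => [|i s [mS IH]]; first by rewrite big_nil mul0r measure0.
  rewrite big_cons; split; first exact: measurableU.
  apply: le_trans (measureU2 _ _ _) _ => //.
  by rewrite /= -add1n natrD mulrDl mul1r EFinD leeD.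
rewrite (_ : \bigcup_i B i = \big[setU/set0]_(i <- enum I) B i).
  by have := key (enum I); rewrite -cardT.
rewrite -bigcup_seq; apply/seteqP; split => x [i _ Bix]; exists i => //=.
by rewrite mem_enum.
Qed.

Lemma counted_product_tail (R : realType) (L : nat)
    (X : conservative_bandit R L) (n : nat) (d : measure_display)
    (Omega : measurableType d) (Pr : probability Omega R)
    (F : nat -> set (set Omega))
    (W : nat -> Omega -> L.-tuple (measurableTypeR R))
    (A : nat -> Omega -> {set 'I_L}) (e : 'I_L) (s : nat) (t a : R) :
  iucb2_run X n Pr F W A -> 0 < a ->
  let M x := \prod_(i < n.+1) (if counted (A ^~ x) e s i then
    expR (t * ((tnth (W i x) e : R) - mean_weight X e) - t ^+ 2 / 8) else 1) in
  measurable [set x | (a <= M x)%R] /\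
  (Pr [set x | (a <= M x)%R] <= (a^-1)%:E)%E.
Proof.
move=> run a0 M.
have [_ /(_ t) mgf] := mean_weight_mgf R L X e.
have [mM M1] := thinned_product_le1 R _ _ Omega _ Pr (law X) F W
  (fun i x => counted (A ^~ x) e s i)
  (fun y => expR (t * ((tnth y e : R) - mean_weight X e) - t ^+ 2 / 8)) n.+1
  (past_sigma_algebra run) (past_measurable run) (past_increasing run)
  (fun i => draw_past run (t := i))
  (fun i ilen G S FG mS => etrans (draw_fresh run ilen FG mS)
    (congr1 (mule (Pr G)) (draw_law run ilen mS)))
  (fun i => counted_past _ _ _ _ _ _ _ _ _ _ e s i run)
  ltac:(apply: measurableT_comp => //; apply: measurable_funB => //;
        apply: measurable_funM => //; apply: measurable_funB => //;
        exact: (@measurable_tnth _ (measurableTypeR R) L e))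
  (fun=> expR_ge0 _) mgf.
split; last first.
  apply: markov_ge0 => // x; apply: prodr_ge0 => i _.
  by case: ifP => // _; exact: expR_ge0.
rewrite -[X in measurable X]setTI.
rewrite (_ : [set x | _] = M @^-1` `[a, +oo[); first exact: mM.
by apply/seteqP; split => x /=; rewrite in_itv/= andbT.
Qed.

(** * The union bound *)

Theorem theorem3 (R : realType) (L : nat) (X : conservative_bandit R L)
    (n : nat) (d : measure_display) (Omega : measurableType d)
    (Pr : probability Omega R) (F : nat -> set (set Omega))
    (W : nat -> Omega -> L.-tuple (measurableTypeR R))
    (A : nat -> Omega -> {set 'I_L})
    (K_gt0 : (0 < rank X)%N)
    (alphaE : tolerance X = 1 / (rank X)%:R)
    (n_gt0 : (0 < n)%N) (K_dvd_n : (rank X %| n)%N)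
    (run : iucb2_run X n Pr F W A) :
  (1 - tolerance X) * (rank X)%:R = (rank X)%:R - 1 /\
  ((1 - 2 * L%:R / ((rank X)%:R * n%:R))%:E <=
   Pr [set x | forall t : nat, (1 <= t <= n)%N ->
        exists rho : 'I_L -> 'I_L,
          bijection_between (A t x) (baseline X) rho /\
          ((1 - tolerance X) * (rank X)%:R <=
           \sum_(e in A t x)
              (mean_weight X (rho e) <= mean_weight X e)%R%:R)%R])%E.
Proof.
have K0 : (rank X)%:R != 0 :> R by rewrite pnatr_eq0 -lt0n.
have tolE : (1 - tolerance X) * (rank X)%:R = (rank X)%:R - 1.
  by rewrite alphaE; field.
split=> //; rewrite tolE.
set G := [set x | _].
(* At each step the condition depends only on the action, which takes finitely many values. *)
have mG : measurable G.
  pose ok (C : {set 'I_L}) := exists rho : 'I_L -> 'I_L,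
    bijection_between C (baseline X) rho /\
    (rank X)%:R - 1 <=
      \sum_(e in C) (mean_weight X (rho e) <= mean_weight X e)%R%:R :> R.
  rewrite (_ : G = \bigcap_(t in [set t | (1 <= t <= n)%N])
      \bigcup_(C in [set C | ok C]) [set x | A t x = C]).
    apply: bigcap_measurableType => t /= tn.
    apply: fin_bigcup_measurable => // C _.
    by apply: (past_measurable run (t := t)); exact: (action_past run).
  apply/seteqP; split => x Gx t tn.
    by exists (A t x) => //; exact: Gx.
  by have [C okC ->] := Gx t tn.
(* A triple consists of an item, a number of observations minus 1, and a sign. *)
pose T (i : 'I_L * 'I_n * bool) : R :=
  (-1) ^+ i.2 * 4 * Defs.radius R n i.1.2.+1.
pose Bad (i : 'I_L * 'I_n * bool) := [set x | (n%:R ^+ 3 <=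
  \prod_(k < n.+1) (if counted (A ^~ x) i.1.1 i.1.2.+1 k then
    expR (T i * ((tnth (W k x) i.1.1 : R) - mean_weight X i.1.1) -
          T i ^+ 2 / 8) else 1))%R].
have n30 : 0 < n%:R ^+ 3 :> R by rewrite exprn_gt0// ltr0n.
have [mB PB] := measure_bigcup_fin_le R _ Omega Pr _ Bad _
  (fun i => proj1 (counted_product_tail _ _ _ _ _ _ _ _ _ _ _ _ (T i) _ run n30))
  (fun i => proj2 (counted_product_tail _ _ _ _ _ _ _ _ _ _ _ _ (T i) _ run n30)).
have GB : ~` G `<=` \bigcup_i Bad i.
  rewrite -[X in _ `<=` X]setCK; apply: classical_sets.subsetC => x nB t /andP[t1 tn].
  pose K := rank X; pose r := (t.-1 %/ K)%N.
  have jK : (t.-1 %% K < K)%N by rewrite ltn_mod.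
  (* Steps are numbered from 1, rounds and positions within a round from 0. *)
  have tE : t = (r * K + Ordinal jK).+1 by rewrite /= -divn_eq prednK.
  have rn : (r < n %/ K)%N.
    rewrite ltn_divRL// (leq_ltn_trans (leq_trunc_div _ _))//.
    by rewrite -ltnS prednK.
  have [e|||rho bij le_rho] := iucb2_action_matching R L X n
    (fun t e => tnth (W t x) e : R) (A ^~ x) (mean_weight X) r (Ordinal jK).
  - by have [] := mean_weight_mgf R L X e.
  - move=> e; rewrite leNgt; apply/negP => dev; apply: nB.
    set s := num_obs _ _ _ _ in dev.
    (* Before a round at most [r * K + 1] draws have been made, and [r * K < n]; so counts up to [n]
       suffice although there are [n + 1] draws. *)
    have sn : (s <= n)%N.
      rewrite /s /num_obs /observation_times size_filter.
      apply: leq_trans (count_size _ _) _; rewrite size_iota.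
      by rewrite (leq_trans _ (leq_trunc_div n K))// -ltnS ltnS ltn_pmul2r.
    (* The initial observation always counts. *)
    have s0 : (0 < s)%N by rewrite /s /num_obs /observation_times.
    (* The observations made before the round are a prefix of those of the whole run, so [emp_mean]
       really averages [s] of them. *)
    have sobs : (s <= size (observation_times (A ^~ x) n.+1 e))%N.
      rewrite /s /num_obs /observation_times.
      have le_n : (r * K < n)%N.
        by rewrite (leq_trans _ (leq_trunc_div n K))// ltn_pmul2r.
      rewrite (_ : n.+1 = (r * K).+1 + (n - r * K))%N; last first.
        by rewrite addSn subnKC// ltnW.
      by rewrite iotaD filter_cat size_cat leq_addr.
    have [b le_b] := deviation_product R L n s (fun t e => tnth (W t x) e : R)
      (A ^~ x) e (mean_weight X e) n_gt0 ltac:(by rewrite s0) dev.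
    have s1n : (s.-1 < n)%N by rewrite prednK.
    by exists (e, Ordinal s1n, b).
  - exact: (action_rule run).
  - by exists rho; rewrite tE.
have PG : (Pr (~` G) <= (2 * L%:R / ((rank X)%:R * n%:R))%:E)%E.
  apply: le_trans (le_measure Pr _ _ GB) _; rewrite ?inE//.
    exact: measurableC.
  apply: le_trans PB _; rewrite lee_fin !card_prod !card_ord card_bool.
  have n0 : (n%:R : R) != 0 by rewrite pnatr_eq0 -lt0n.
  rewrite (_ : (L * n * 2)%:R * _ = 2 * L%:R / (n%:R * n%:R)); last first.
    by rewrite !natrM; move: (L%:R : R) (n%:R : R) n0 => l k k0; field.
  (* It remains to use [K <= n], which holds because [K] divides the positive [n]. *)
  rewrite ler_wpM2l ?mulr_ge0// lef_pV2 ?posrE ?mulr_gt0 ?ltr0n//.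
  by rewrite ler_wpM2r// ler_nat dvdn_leq.
have -> : Pr G = (1 - Pr (~` G))%E.
  by rewrite -probability_setC ?setCK//; exact: measurableC.
by rewrite EFinB leeB.
Qed.
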